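(* Let $d\ge1$ be an integer and let $0\le\beta<d$. Let $Y \subset \mathbf{R}^d$ be a countable union of bounded sets, each of Minkowski dimension at most $\beta$. Then there exists a set $X \subset \mathbf{R}^d$ with Hausdorff dimension at least $d - \beta$ such that $X + X$ is disjoint from $Y$.
   Context: Here $X+X=\{x+y : x,y\in X\}$, where $x=y$ is allowed. For a length $l>0$ and $E\subset\mathbf{R}^d$, let $\mathcal{B}^d_l(E)$ be the collection of half-open cubes $[a_1,a_1+l)\times\cdots\times[a_d,a_d+l)$, $a_1,\dots,a_d\in l\cdot\mathbf{Z}$, that intersect $E$. The lower and upper Minkowski dimensions of a bounded set $E$ are respectively the $\liminf$ and $\limsup$, as $l\to0$, of $\frac{\log(\#\mathcal{B}^d_l(E))}{\log(1/l)}$; the Minkowski dimension of $E$ is their common value when they coincide. *)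

(* Defs.v *)
From HB Require Import structures.
From mathcomp Require Export all_boot all_order all_algebra finmap.
From mathcomp Require Export all_classical all_reals all_analysis.

Set Implicit Arguments.
Unset Strict Implicit.
Unset Printing Implicit Defensive.

Export Order.TTheory GRing.Theory Num.Theory.
Export numFieldNormedType.Exports.

Local Open Scope classical_set_scope.
Local Open Scope ring_scope.

Definition grid_cube (R : realType) (d : nat) (l : R) (k : 'rV[int]_d) :
    set 'rV[R]_d :=
  [set x | forall i, l * (k 0 i)%:~R <= x 0 i < l * (k 0 i)%:~R + l].

Definition grid_cover (R : realType) (d : nat) (l : R) (E : set 'rV[R]_d) :
    set (set 'rV[R]_d) :=
  [set Q | (exists k, Q = grid_cube l k) /\ Q `&` E !=set0].

(* [fset_set] is the intended finite set because [grid_cover l E] is finite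
   when 0 < l and E is bounded; for infinite covers it would be empty. *)
Definition box_count (R : realType) (d : nat) (l : R) (E : set 'rV[R]_d) : nat :=
  #|` fset_set (grid_cover l E)|.

(* As [ln 0 = 0], the empty set gets Minkowski dimension 0. *)
Definition box_ratio (R : realType) (d : nat) (E : set 'rV[R]_d) (l : R) :
    \bar R :=
  (ln (box_count l E)%:R / ln l^-1)%:E.

Definition lower_minkowski_dim (R : realType) (d : nat) (E : set 'rV[R]_d) :
    \bar R :=
  limf_einf (box_ratio E) (0 : R)^'+.

Definition upper_minkowski_dim (R : realType) (d : nat) (E : set 'rV[R]_d) :
    \bar R :=
  limf_esup (box_ratio E) (0 : R)^'+.

Definition has_minkowski_dim (R : realType) (d : nat) (E : set 'rV[R]_d)
    (D : \bar R) : Prop :=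
  lower_minkowski_dim E = D /\ upper_minkowski_dim E = D.

(* The library norm on 'rV[R]_d is the sup norm, hence an explicit Euclidean
   distance. *)
Definition eucl_dist (R : realType) (d : nat) (x y : 'rV[R]_d) : R :=
  Num.sqrt (\sum_i (x 0 i - y 0 i) ^+ 2).

(* Equal to -oo on the empty set. *)
Definition eucl_diam (R : realType) (d : nat) (U : set 'rV[R]_d) : \bar R :=
  ereal_sup [set (eucl_dist x y)%:E | x in U & y in U].

(* diam(U)^s, with 0^0 = 1 for singletons and value 0 on the empty set. *)
Definition diam_pow (R : realType) (d : nat) (s : R) (U : set 'rV[R]_d) :
    \bar R :=
  if U == set0 then 0%E else (eucl_diam U `^ s)%E.

Definition hausdorff_pre_measure (R : realType) (d : nat) (s delta : R)
    (E : set 'rV[R]_d) : \bar R :=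
  ereal_inf [set (\sum_(0 <= i <oo) diam_pow s (U i))%E |
    U in [set U : nat -> set 'rV[R]_d |
           E `<=` \bigcup_i U i /\
           forall i, (eucl_diam (U i) <= delta%:E)%E]].

(* The supremum is the limit as delta -> 0+, by monotonicity in delta. *)
Definition hausdorff_measure (R : realType) (d : nat) (s : R)
    (E : set 'rV[R]_d) : \bar R :=
  ereal_sup [set hausdorff_pre_measure s delta E |
    delta in [set delta : R | 0 < delta]].

Definition hausdorff_dim (R : realType) (d : nat) (E : set 'rV[R]_d) : \bar R :=
  ereal_inf [set s%:E | s in [set s : R |
    0 <= s /\ hausdorff_measure s E = 0%E]].

(* Main.v *)
Require Import Defs.
From mathcomp Require Import ring lra zify.

(** The set X is obtained by maximality alone.  Zorn's lemma gives a set X that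
    is maximal among the sets whose sumset avoids Y.  Maximality means that no
    point z can be added: either z already lies in X, or z + z lies in Y, or
    z + x lies in Y for some x in X.  Hence R^d is the union of X, Y/2 and Y - X.

    It remains to see that these three sets cannot fill R^d when X has Hausdorff
    dimension less than d - beta.  In that case H^s(X) = 0 for some s < d - beta,
    and there is t with beta < t < d - s.  A piece E of Y is covered by at most
    l^-t cubes of side comparable to l, for every small l.  If U has diameter at
    most l, then E - U is covered by as many cubes of side comparable to l, so
    its outer volume is at most a constant times l^(d-t), which is at most
    l^s.  Summing over a cover of X by sets U_i of diameter l_i with small
    sum of l_i^s shows that E - X is a null set ([volume_sum_eq0]).  The
    same estimate with E reduced to a point, or with U reduced to a point, shows
    that X and E/2 are null.  As there are countably many pieces E, the whole
    space would be null.

    Only a very small part of Lebesgue measure is used: the outer volume defined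
    by covers with countably many cubes is countably subadditive
    ([volume_bigcup_le]) and does not vanish on the unit cube
    ([volume_unit_cube]).  The latter follows from compactness and from counting
    the points of a fine grid in each cube of a finite cover. *)

Set Implicit Arguments.
Unset Strict Implicit.
Unset Printing Implicit Defensive.

Local Open Scope classical_set_scope.
Local Open Scope ring_scope.

(** * Outer volume defined by covers with cubes *)

Lemma rV_ballP {R : realType} {d : nat} {q x : 'rV[R]_d} {l : R} :
  ball q l x <-> 0 < l /\ forall i, `|q 0 i - x 0 i| < l.
Proof.
split=> -[l0 qx]; split=> // i; first exact: qx.
by move=> j; rewrite ord1; exact: qx.
Qed.

Section Volume.
Context {R : realType} {d : nat}.
Implicit Types (A : set 'rV[R]_d).

(** Balls of the sup norm are open cubes.  Radius zero is allowed and gives the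
    empty set, so that a finite cover is also a countable one. *)
Definition ball_cover A (c : nat -> 'rV[R]_d) (r : nat -> R) :=
  (forall i, 0 <= r i) /\ A `<=` \bigcup_i ball (c i) (r i).

(** Up to the factor 2^d, the Lebesgue outer measure of A: a cube of radius r
    is counted with weight r^d. *)
Definition volume A : \bar R :=
  ereal_inf [set (\sum_(0 <= i <oo) (cr.2 i ^+ d)%:E)%E |
    cr in [set cr | ball_cover A cr.1 cr.2]].

Lemma volume_le_cover A c r :
  ball_cover A c r -> (volume A <= \sum_(0 <= i <oo) (r i ^+ d)%:E)%E.
Proof. by move=> Acr; apply: ereal_inf_lbound; exists (c, r). Qed.

Lemma volume_ge0 A : (0 <= volume A)%E.
Proof.
apply: le_ereal_inf_tmp => _ [[c r] /= [r0 _] <-].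
by apply: nneseries_ge0 => i _ _; rewrite lee_fin exprn_ge0.
Qed.

Lemma le_volume A B : A `<=` B -> (volume A <= volume B)%E.
Proof.
move=> AB; apply: le_ereal_inf_tmp => _ [[c r] /= [r0 Bcr] <-].
by apply: volume_le_cover; split => //; exact: subset_trans Bcr.
Qed.

Lemma volume_bigcup_le (A : nat -> set 'rV[R]_d) :
  (volume (\bigcup_n A n) <= \sum_(0 <= n <oo) volume (A n))%E.
Proof.
(* Almost optimal covers of the A n, with errors e / 2^(n+1), are put together
   along a bijection between nat and nat * nat. *)
have [[n Anoo]|Afin] := pselect (exists n, volume (A n) = +oo%E).
  rewrite (eseries_pinfty _ _ Anoo) ?leey// => k _.
  by rewrite -ltNye (lt_le_trans _ (volume_ge0 _)).
apply/lee_addgt0Pr => e e0.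
have e2 n : 0 < e / (2 ^ n.+1)%:R by rewrite divr_gt0// ltr0n expn_gt0.
have /choice[G PG] n : exists cr : (nat -> 'rV[R]_d) * (nat -> R),
    ball_cover (A n) cr.1 cr.2 /\
    (\sum_(0 <= i <oo) (cr.2 i ^+ d)%:E <=
      volume (A n) + (e / (2 ^ n.+1)%:R)%:E)%E.
  have : (volume (A n) < volume (A n) + (e / (2 ^ n.+1)%:R)%:E)%E.
    rewrite lteDl ?lte_fin//; rewrite ge0_fin_numE ?volume_ge0//.
    by rewrite ltey; apply/eqP => Anoo; apply: Afin; exists n.
  by move=> /ereal_inf_lt[_ [cr Acr <-] /ltW ?]; exists cr.
apply: le_trans (epsilon_trick xpredT _ (ltW e0)); last first.
  by move=> n; exact: volume_ge0.
apply: le_trans (lee_nneseries _ (fun n _ => (PG n).2)); last first.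
  by move=> n _ _; apply: nneseries_ge0 => i _ _; rewrite lee_fin exprn_ge0// (PG n).1.1.
have G0 n i : (0 <= ((G n).2 i ^+ d)%:E)%E by rewrite lee_fin exprn_ge0// (PG n).1.1.
rewrite nneseries_esumT; last by move=> n; apply: nneseries_ge0.
under eq_esum do rewrite nneseries_esumT//.
rewrite esum_esum//.
have /card_esym/ppcard_eqP[f] := card_nat2.
rewrite (reindex_esum setT _ f); last first.
  by rewrite (_ : _ `*`` _ = setT)//; apply/seteqP; split.
rewrite -(@nneseries_esumT _ (fun n => ((G (f n).1).2 (f n).2 ^+ d)%:E))//.
apply: (@volume_le_cover _ (fun n => (G (f n).1).1 (f n).2)
  (fun n => (G (f n).1).2 (f n).2)).
split=> [n|x [n _ /(PG n).1.2[i _ xi]]]; first exact: (PG _).1.1.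
by exists (f^-1%FUN (n, i)) => //=; rewrite invK ?inE.
Qed.

Lemma volume_bigcup_eq0 (A : nat -> set 'rV[R]_d) :
  (forall n, volume (A n) = 0%E) -> volume (\bigcup_n A n) = 0%E.
Proof.
move=> A0; apply/eqP; rewrite eq_le volume_ge0 andbT.
by apply: le_trans (volume_bigcup_le _) _; rewrite eseries0.
Qed.

Lemma volume_finite_cover A (qs : seq 'rV[R]_d) (l : R) : (0 < d)%N -> 0 <= l ->
  (forall x, A x -> exists2 q, q \in qs & ball q l x) ->
  (volume A <= ((size qs)%:R * l ^+ d)%:E)%E.
Proof.
move=> d0 l0 Aqs.
pose r i := if (i < size qs)%N then l else 0.
have r0 i : 0 <= r i by rewrite /r; case: ifP.
apply: (@le_trans _ _ (\sum_(0 <= i <oo) (r i ^+ d)%:E)%E).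
  apply: (@volume_le_cover _ (nth 0 qs)); split=> // x /Aqs[q qqs qx].
  by exists (index q qs) => //; rewrite /r index_mem qqs nth_index.
rewrite (nneseries_split 0 (size qs)); last by move=> i _; rewrite lee_fin exprn_ge0.
rewrite add0n eseries0 ?adde0; last first.
  by move=> i; rewrite /r leqNgt => /negbTE -> _; rewrite expr0n gtn_eqF.
rewrite sumEFin lee_fin (eq_big_nat _ _ (F2 := fun=> l ^+ d)); last first.
  by move=> i /andP[_ iq]; rewrite /r iq.
by rewrite sumr_const_nat subn0 mulr_natl.
Qed.

End Volume.

(** * The unit cube has positive volume *)

(** An open interval of length 2r contains at most 2rn + 1 points of the grid of
    step 1/n; the assumption on n absorbs the additive constant. *)
Lemma card_grid_interval (R : realType) (n : nat) (c r : R) :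
  (0 < n)%N -> 1 <= 2 * r * n%:R ->
  #|[pred k : 'I_n | `|c - k%:R / n%:R| < r]|%:R <= 4 * r * n%:R.
Proof.
move=> n0 rn; set K := [pred k | _].
have n0' : 0 < n%:R :> R by rewrite ltr0n.
have rn0 : 0 <= 2 * r * n%:R by rewrite (le_trans ler01).
have [k1 k1K|K0] := pickP K; last by rewrite (eq_card0 K0); lra.
case: (@arg_minnP _ k1 K (fun k : 'I_n => k : nat) k1K) => k0 k0K k0min.
pose m := Num.truncn (2 * r * n%:R).
have Km k : k \in K -> (k - k0 < m.+1)%N.
  move=> kK; rewrite ltnS truncn_ge_nat// natrB ?k0min//.
  move: kK k0K; rewrite !inE => kc k0c.
  have : `|k%:R / n%:R - k0%:R / n%:R| <= 2 * r :> R.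
    have := ler_normB (c - k0%:R / n%:R) (c - k%:R / n%:R).
    rewrite (_ : c - _ - _ = k%:R / n%:R - k0%:R / n%:R); last by ring.
    by lra.
  rewrite -mulrBl => /(le_trans (ler_norm _)).
  by rewrite ler_pdivrMr.
(* All grid indices in the interval lie within m of the smallest one. *)
have inj : {in K &, injective (fun k : 'I_n => inord (k - k0) : 'I_m.+1)}.
  move=> k k' kK k'K /(congr1 val); rewrite /= !inordK ?Km// => kk'.
  apply/val_inj => /=; rewrite -(subnK (k0min _ kK)) -(subnK (k0min _ k'K)).
  by rewrite kk'.
have : (#|K| <= m.+1)%N.
  by rewrite -(card_in_image inj) (leq_trans (max_card _))// card_ord.
rewrite -(ler_nat R) => /le_trans; apply.
have : m%:R <= 2 * r * n%:R by rewrite -truncn_ge_nat.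
by rewrite -natr1; lra.
Qed.

Section UnitCube.
Context {R : realType} {d : nat}.

Definition unit_cube : set 'rV[R]_d := [set x | forall i, 0 <= x 0 i <= 1].

Definition grid_point n (f : {ffun 'I_d -> 'I_n}) : 'rV[R]_d :=
  \row_i ((f i)%:R / n%:R).

Lemma grid_point_in_cube n f : (0 < n)%N -> unit_cube (@grid_point n f).
Proof.
move=> n0 i; rewrite mxE divr_ge0 ?ler0n//=.
by rewrite ler_pdivrMr ?ltr0n// mul1r ler_nat ltnW.
Qed.

Lemma card_grid_ball n (c : 'rV[R]_d) (r : R) : (0 < n)%N -> 0 <= r ->
  (0 < r -> 1 <= 2 * r * n%:R) -> (0 < d)%N ->
  #|[pred f : {ffun 'I_d -> 'I_n} | `[< ball c r (grid_point f) >]]|%:R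
    <= (4 * r * n%:R) ^+ d.
Proof.
move=> n0; rewrite le_eqVlt => /predU1P[<- _ d0|r0 /(_ r0) rn d0].
  rewrite eq_card0 ?exprn_ge0 ?mulr0 ?mul0r// => f.
  by apply/asboolP; rewrite le0_ball0.
pose F (i : 'I_d) := [pred k : 'I_n | `|c 0 i - k%:R / n%:R| < r].
apply: (@le_trans _ _ #|family F|%:R).
  rewrite ler_nat; apply/subset_leq_card/fintype.subsetP => f.
  rewrite inE => fc; apply/familyP => i; rewrite inE.
  by have := (proj1 rV_ballP fc).2 i; rewrite mxE.
rewrite card_family foldrE big_map big_enum /= natr_prod.
rewrite -[X in _ <= X](_ : \prod_(i < d) (4 * r * n%:R) = _); last first.
  by rewrite prodr_const card_ord.
apply: ler_prod => i _; rewrite ler0n /=.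
exact: card_grid_interval.
Qed.

(** By compactness a cover may be taken finite.  If n is large, the n^d points of
    the grid of step 1/n lie in the cube, and a ball of radius r contains at most
    (4rn)^d of them, so that n^d is at most the sum of the (4 r_i n)^d. *)
Lemma volume_unit_cube : (0 < d)%N -> ((4^-1 ^+ d)%:E <= volume unit_cube)%E.
Proof.
move=> d0; apply: le_ereal_inf_tmp => _ [[c r] /= [r0 cubecr] <-].
have : compact unit_cube.
  have := @rV_compact R d (fun=> `[0, 1]%classic) (fun=> @segment_compact _ _ _).
  congr compact; apply/seteqP; split=> x /= xI i; have := xI i;
    by rewrite /= in_itv.
rewrite compact_cover => /(_ _ setT (fun i => ball (c i) (r i))).
move=> /(_ (fun i _ => ball_open _ _) cubecr)[D _ cubeD].
pose M := (\max_(i <- D) i).+1.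
(* n exceeds the inverses of all positive radii of the finite subcover. *)
pose n := (\max_(i < M) Num.truncn (r i)^-1).+1.
have rn i : (i < M)%N -> 0 < r i -> 1 <= 2 * r i * n%:R.
  move=> iM ri0.
  have : (r i)^-1 < n%:R.
    rewrite -truncn_le_nat.
    exact: (leq_bigmax (Ordinal iM)).
  rewrite -(ltr_pM2l ri0) mulfV ?gt_eqF// => ?; nra.
apply: le_trans (nneseries_lim_ge M _) => //; last first.
  by move=> i _ _; rewrite lee_fin exprn_ge0.
rewrite sumEFin lee_fin big_mkord.
pose B (i : 'I_M) :=
  [pred f : {ffun 'I_d -> 'I_n} | `[< ball (c i) (r i) (grid_point f) >]].
have : ((n ^ d)%:R : R) <= \sum_(i < M) (#|B i|)%:R.
  rewrite -natr_sum ler_nat.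
  have <- : #|{: {ffun 'I_d -> 'I_n}}| = (n ^ d)%N.
    by rewrite card_ffun !card_ord.
  rewrite -sum1_card (eq_bigr (fun i => \sum_(f in B i) 1)%N); last first.
    by move=> i _; rewrite sum1_card.
  rewrite (exchange_big_dep xpredT)//=; apply: leq_sum => f _.
  have [i iD fi] := cubeD _ (grid_point_in_cube f (ltn0Sn _)).
  have iM : (i < M)%N by rewrite ltnS (big_rem i)//= leq_maxl.
  rewrite (bigD1 (Ordinal iM)) ?leq_addr//=.
  by rewrite !inE.
have n0 : (0 < n)%N by [].
move=> nB; have {nB} : ((n ^ d)%:R : R) <= \sum_(i < M) (4 * r i * n%:R) ^+ d.
  apply: le_trans nB _; apply: ler_sum => i _.
  exact: card_grid_ball (rn i (ltn_ord i)) d0.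
under eq_bigr do rewrite mulrAC exprMn.
rewrite -mulr_sumr natrX exprMn -[leLHS]mul1r [4 ^+ d * _]mulrC -mulrA.
have nd0 : 0 < n%:R ^+ d :> R by rewrite exprn_gt0// ltr0n.
rewrite mulrC ler_pM2l//.
by rewrite exprVn -ler_pdivrMl ?exprn_gt0// mulr1.
Qed.

End UnitCube.

(** * Null sets *)

Section NullSets.
Context {R : realType} {d : nat}.
Implicit Types (A : set 'rV[R]_d).

Lemma volume_set0 : (0 < d)%N -> volume (set0 : set 'rV[R]_d) = 0%E.
Proof.
move=> d0; apply/eqP; rewrite eq_le volume_ge0 andbT.
by have := @volume_finite_cover R d set0 [::] 0 d0 (lexx _); rewrite /= mul0r; apply.
Qed.

Lemma volume_countable_bigcup_eq0 {T : Type} (F : set T) (A : T -> set 'rV[R]_d) :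
  (0 < d)%N -> countable F -> (forall t, F t -> volume (A t) = 0%E) ->
  volume (\bigcup_(t in F) A t) = 0%E.
Proof.
move=> d0 /countable_injP[f finj] A0.
pose B n := \bigcup_(t in F `&` f @^-1` [set n]) A t.
have -> : \bigcup_(t in F) A t = \bigcup_n B n.
  apply/seteqP; split=> [x [t Ft Atx]|x [n _ [t [Ft _] Atx]]]; last by exists t.
  by exists (f t) => //; exists t.
apply: volume_bigcup_eq0 => n.
have [[t [Ft ft]]|noF] := pselect (exists t, F t /\ f t = n).
  apply/eqP; rewrite eq_le volume_ge0 andbT -(A0 _ Ft).
  apply: le_volume => x [t' [Ft' ft'] At'x].
  by rewrite (finj t t') ?inE//= ft.
rewrite (_ : B n = set0) ?volume_set0//.
by apply/seteqP; split=> // x [t [Ft ft] _]; apply: noF; exists t.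
Qed.

Lemma volume_setU_eq0 A B : (0 < d)%N ->
  volume A = 0%E -> volume B = 0%E -> volume (A `|` B) = 0%E.
Proof.
move=> d0 A0 B0.
have h := @volume_countable_bigcup_eq0 bool setT (fun b => if b then A else B)
  d0 (countableP _).
rewrite -h => [|[]//]; congr volume.
apply/seteqP; split=> [x [Ax|Bx]|x [[] _ ?]]; [exists true|exists false|left|right] => //.
Qed.

End NullSets.

(** * Covers obtained from the Minkowski dimension *)

Section Covering.
Context {R : realType} {d : nat}.
Implicit Types (E X U : set 'rV[R]_d).

(** The form in which a bound on the upper Minkowski dimension is used: it is
    weaker than the bound on the number of grid cubes, but it does not refer
    to a grid and is therefore easy to transport to sums. *)
Definition covering_exponent (t l0 : R) E := forall l, 0 < l < l0 ->
  exists2 qs : seq 'rV[R]_d,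
    (forall x, E x -> exists2 q, q \in qs & ball q l x) &
    (size qs)%:R <= l `^ (- t).

Lemma bounded_entries E : bounded_set E ->
  exists M : R, forall x, E x -> forall i, `|x 0 i| <= M.
Proof.
move=> [M [_ EM]]; exists (M + 1) => x Ex i.
have : `|x| <= M + 1 by apply: EM => //; rewrite ltrDl.
apply: le_trans; rewrite /Num.norm/= mx_normrE.
exact: (le_bigmax _ (fun ij => `|x ij.1 ij.2|) (0, i)).
Qed.

(** This makes [box_count] the true number of cubes, as [fset_set] of an infinite
    set would be empty. *)
Lemma finite_grid_cover E (l : R) :
  bounded_set E -> 0 < l -> finite_set (grid_cover l E).
Proof.
move=> /bounded_entries[M EM] l0.
pose m := (Num.truncn (M / l + 1)).+1.
pose k_of (f : {ffun 'I_d -> 'I_(2 * m).+1}) : 'rV[int]_d :=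
  \row_i ((f i)%:Z - m%:Z).
apply: (@sub_finite_set _ _ [set grid_cube l (k_of f) | f in setT]); last first.
  exact/finite_image/finite_finset.
move=> _ [[k ->] [x [kx Ex]]].
have km i : `|(k 0 i)%:~R : R| < m%:R.
  apply: le_lt_trans (truncnS_gt _).
  have := EM _ Ex i; have := kx i; rewrite ler_norml => /andP[k1 k2] /andP[M1 M2].
  rewrite ler_norml -(ler_pM2l l0) -[X in _ && X](ler_pM2l l0) mulrN mulrDr mulr1.
  by rewrite mulrCA mulfV ?gt_eqF// mulr1; apply/andP; split; lra.
have km' i : `|k 0 i| < m%:Z by have := km i; rewrite -intr_norm -(ltr_int R).
exists [ffun i : 'I_d => inord `|(k 0 i + m%:Z)%R|%N] => //.
congr grid_cube; apply/rowP => i; rewrite mxE ffunE.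
have := km' i; move: (k 0 i) => z; rewrite ltr_norml => /andP[z1 z2].
by rewrite inordK; lia.
Qed.

(** A half-open cube of side l lies in the open ball of radius l centred at its
    lowest corner.  The bound on the number N of cubes is ln N < t ln (1/l), that
    is N < l^-t; the radius must stay below 1 for ln (1/l) to be positive. *)
Lemma minkowski_covering E (t : R) : bounded_set E ->
  (upper_minkowski_dim E < t%:E)%E ->
  exists2 l0, 0 < l0 & covering_exponent t l0 E.
Proof.
move=> Ebd /ereal_inf_lt[_ [V V0 <-] supV].
have [e /= e0 eV] := V0.
exists (Num.min e 1); first by rewrite lt_min e0 ltr01.
move=> l /andP[l0]; rewrite lt_min => /andP[le l1].
have Vl : V l.
  by apply: eV => //=; rewrite sub0r normrN gtr0_norm.
have : (box_ratio E l < t%:E)%E.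
  by apply: le_lt_trans supV; apply: ereal_sup_ubound; exists l.
have lnl : 0 < ln l^-1 by rewrite ln_gt0// invf_gt1.
rewrite /box_ratio lte_fin ltr_pdivrMr// lnV ?posrE// => Nlt.
have Efin := finite_grid_cover Ebd l0.
(* The centre depends on the set Q alone, so that there are as many centres as
   cubes. *)
pose corner (Q : set 'rV[R]_d) := get [set q | forall x, Q x -> ball q l x].
exists [seq corner Q | Q <- fset_set (grid_cover l E)].
  move=> x Ex.
  pose k : 'rV[int]_d := \row_i Num.floor (x 0 i / l).
  have kx : grid_cube l k x.
    move=> i; rewrite mxE; have := floor_itv (x 0 i / l).
    rewrite ler_pdivlMr// ltr_pdivrMr// intrD mulrDl mul1r.
    by rewrite mulrC.
  exists (corner (grid_cube l k)).
    apply: map_f; rewrite in_fset_set// inE; split; first by exists k.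
    by exists x.
  have /getPex : [set q | forall x, grid_cube l k x -> ball q l x] !=set0.
    exists (\row_i (l * (k 0 i)%:~R)) => y ky; apply/rV_ballP; split=> // i.
    by rewrite !mxE distrC; have := ky i; rewrite ltr_norml mxE; lra.
  exact.
rewrite size_map -/(box_count l E).
have [->|N0] := posnP (box_count l E); first exact: powR_ge0.
rewrite ltW// -ltr_ln ?posrE ?ltr0n ?powR_gt0// ln_powR mulNr -mulrN//.
Qed.

(** * Sums of a set of small Minkowski dimension and an H^s-null set *)

(** As U has diameter at most l, the sum of a ball of radius l with U stays in a
    ball of radius 2l, so a E + b U needs no more balls than E: at most l^-t
    balls of weight (2l)^d.  The coefficients a and b make one statement serve
    for differences, for translates of U and for dilates of E. *)
Lemma volume_sum_le (a b t l0 l : R) E U : (0 < d)%N ->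
  `|a| <= 1 -> `|b| <= 1 -> covering_exponent t l0 E -> 0 < l < l0 ->
  (forall u v, U u -> U v -> forall i, `|u 0 i - v 0 i| <= l) ->
  (volume [set (a *: e + b *: u)%R | e in E & u in U]
    <= (2 ^+ d * l `^ (d%:R - t))%:E)%E.
Proof.
move=> d0 a1 b1 Et /[dup] ll0 /andP[l0_gt0 _] diamU.
have [qs Eqs sizeqs] := Et _ ll0.
apply: (le_trans (@volume_finite_cover _ _ _
  [seq a *: q + b *: get U | q <- qs] (2 * l) d0 _ _)); first by lra.
  move=> _ [e Ee [u Uu <-]]; have [q qqs eq] := Eqs _ Ee.
  exists (a *: q + b *: get U); first by apply/mapP; exists q.
  have Uget : U (get U) by apply: getPex; exists u.
  have [_ {}eq] := proj1 rV_ballP eq.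
  apply/rV_ballP; split=> [|i]; first by lra.
  rewrite !mxE.
  rewrite (_ : _ - _ = a * (q 0 i - e 0 i) + b * (get U 0 i - u 0 i)); last by ring.
  apply: le_lt_trans (ler_normD _ _) _; rewrite !normrM mulr_natl mulr2n.
  apply: ltr_leD.
    by apply: le_lt_trans (eq i); rewrite ler_piMl.
  by apply: le_trans (diamU _ _ Uget Uu i); rewrite ler_piMl.
rewrite lee_fin size_map exprMn mulrCA ler_wpM2l ?exprn_ge0//.
rewrite addrC powRD; last by rewrite (gt_eqF l0_gt0)/= implybT.
by rewrite (powR_mulrn _ (ltW l0_gt0)) ler_wpM2r ?exprn_ge0 ?(ltW l0_gt0).
Qed.

Lemma le_eucl_dist (x y : 'rV[R]_d) i : `|x 0 i - y 0 i| <= eucl_dist x y.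
Proof.
rewrite -sqrtr_sqr ler_sqrt ?sumr_ge0// => [|j _]; last exact: sqr_ge0.
by rewrite (bigD1 i)//= lerDl sumr_ge0// => j _; exact: sqr_ge0.
Qed.

(** The scale l attached to a member U of a cover is the diameter of U, except
    when that diameter is too small, possibly zero; l is then any length with
    l^p at most e.  In the first case l^p is at most diam(U)^s because l is at
    most 1. *)
Lemma exists_side (s p delta e : R) U : 0 <= s <= p -> 0 < p -> 0 < delta <= 1 ->
  0 < e -> (eucl_diam U <= delta%:E)%E ->
  exists l, [/\ 0 < l <= delta,
    forall u v, U u -> U v -> forall i, `|u 0 i - v 0 i| <= l &
    ((l `^ p)%:E <= diam_pow s U + e%:E)%E].
Proof.
move=> /andP[s0 sp] p0 /andP[delta0 delta1] e0 Udelta.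
pose h := Num.min (e `^ p^-1) delta.
have h0 : 0 < h by rewrite lt_min powR_gt0.
have hdelta : h <= delta by rewrite ge_min lexx orbT.
have hp : h `^ p <= e.
  apply: (@le_trans _ _ ((e `^ p^-1) `^ p)).
    by apply: ge0_ler_powR; rewrite ?nnegrE ?powR_ge0 ?(ltW p0) ?(ltW h0)// ge_min lexx.
  by rewrite -powRrM mulVf ?gt_eqF// powRr1// ltW.
have [->|/set0P[u0 Uu0]] := eqVneq U set0.
  exists h; split; rewrite ?h0//.
  by rewrite /diam_pow eqxx add0e lee_fin.
have diam_ub u v : U u -> U v -> ((eucl_dist u v)%:E <= eucl_diam U)%E.
  by move=> Uu Uv; apply: ereal_sup_ubound; exists u => //; exists v.
have diam0 : (0 <= eucl_diam U)%E.
  by apply: le_trans (diam_ub _ _ Uu0 Uu0); rewrite lee_fin sqrtr_ge0.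
have diamfin : eucl_diam U \is a fin_num.
  by rewrite ge0_fin_numE// (le_lt_trans Udelta) ?ltry.
rewrite /diam_pow ifF; last by apply/eqP => U0; rewrite U0 in Uu0.
move: diam0 Udelta diam_ub; rewrite -(fineK diamfin) lee_fin lee_fin.
set D := fine _ => D0 Ddelta diam_ub.
exists (Num.max D h); split.
- by rewrite lt_max h0 orbT ge_max Ddelta.
- move=> u v Uu Uv i; rewrite le_max; apply/orP; left.
  by apply: le_trans (le_eucl_dist _ _ _) _; rewrite -lee_fin diam_ub.
rewrite poweR_EFin -EFinD lee_fin.
have [Dh|hD] := leP D h; first by rewrite (le_trans hp)// lerDr powR_ge0.
apply: (@le_trans _ _ (D `^ s)); last by rewrite lerDl ltW.
by apply: ger_powR => //; rewrite (lt_trans h0 hD) (le_trans Ddelta).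
Qed.

(** This is [volume_sum_le] with U a point, where the scale l may tend to 0. *)
Lemma volume_dilate_eq0 (a t l0 : R) E : (0 < d)%N -> `|a| <= 1 -> t < d%:R ->
  0 < l0 -> covering_exponent t l0 E -> volume [set a *: e | e in E] = 0%E.
Proof.
move=> d0 a1 td l00 Et; apply/eqP; rewrite eq_le volume_ge0 andbT.
apply/lee_addgt0Pr => eta eta0; rewrite add0e.
have p0 : 0 < d%:R - t by rewrite subr_gt0.
have d2 : 0 < 2 ^+ d :> R by rewrite exprn_gt0.
(* For the empty set, [exists_side] gives arbitrarily small powers of l. *)
have [|||||l [/andP[lgt0 ll0] _]] :=
  @exists_side 0 (d%:R - t) (Num.min (l0 / 2) 1) (eta / 2 ^+ d) set0.
- by rewrite lexx ltW.
- by [].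
- by rewrite lt_min divr_gt0//= ltr01/= ge_min lexx orbT.
- by rewrite divr_gt0.
- rewrite /eucl_diam (_ : [set _ | _ in _ & _ in _] = set0) ?ereal_sup0 ?leNye//.
  by apply/seteqP; split=> // ? [].
rewrite /diam_pow eqxx add0e lee_fin ler_pdivlMr// mulrC => leta.
apply: le_trans (_ : _ <= (2 ^+ d * l `^ (d%:R - t))%:E)%E _; last by rewrite lee_fin.
apply: le_trans (@volume_sum_le a 0 t l0 l E [set 0] d0 a1 _ Et _ _).
- apply: le_volume => _ [e Ee <-]; exists e => //; exists 0 => //.
  by rewrite scaler0 addr0.
- by rewrite normr0.
- by rewrite lgt0/=; move: ll0; rewrite le_min => /andP[? _]; lra.
- by move=> _ _ -> -> i; rewrite subrr normr0 ltW.
Qed.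

(** A cover of X by sets U_i with small sum of diam(U_i)^s gives a cover of
    a E + b X by the sets a E + b U_i, of volume at most 2^d l_i^(d-t) with l_i the
    diameter of U_i up to a summable error. *)
Lemma volume_sum_eq0 (a b s t l0 : R) E X : (0 < d)%N ->
  `|a| <= 1 -> `|b| <= 1 -> 0 < l0 -> covering_exponent t l0 E ->
  0 <= s -> s < d%:R - t -> hausdorff_measure s X = 0%E ->
  volume [set a *: e + b *: x | e in E & x in X] = 0%E.
Proof.
move=> d0 a1 b1 l00 Et s0 sp HX; apply/eqP; rewrite eq_le volume_ge0 andbT.
apply/lee_addgt0Pr => eta eta0; rewrite add0e.
have d2 : 0 < 2 ^+ d :> R by rewrite exprn_gt0.
have p0 : 0 < d%:R - t by exact: le_lt_trans sp.
(* Half of eta / 2^d bounds the sum of the diam(U_i)^s, the other half the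
   sum of the errors. *)
pose e := eta / 2 ^+ d / 2.
have e0 : 0 < e by rewrite !divr_gt0.
pose delta := Num.min (l0 / 2) 1.
have delta0 : 0 < delta by rewrite lt_min divr_gt0//= ltr01.
have deltal0 : delta < l0.
  by apply: (@le_lt_trans _ _ (l0 / 2)); [rewrite ge_min lexx|lra].
have : (hausdorff_pre_measure s delta X < e%:E)%E.
  apply: (@le_lt_trans _ _ 0%E); last by rewrite lte_fin.
  by rewrite -HX; apply: ereal_sup_ubound; exists delta.
move=> /ereal_inf_lt[_ [U [XU Udelta] <-] /ltW sumU].
have e2 n : 0 < e / (2 ^ n.+1)%:R by rewrite divr_gt0// ltr0n expn_gt0.
have delta01 : 0 < delta <= 1 by rewrite delta0 ge_min lexx orbT.
have sp01 : 0 <= s <= d%:R - t by rewrite s0 ltW.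
have /choice[l Pl] i := @exists_side s (d%:R - t) delta _ (U i)
  sp01 p0
  delta01 (e2 i) (Udelta i).
pose S i := [set a *: e + b *: u | e in E & u in U i].
apply: (@le_trans _ _ (volume (\bigcup_i S i))).
  apply: le_volume => _ [y Ey [x Xx <-]]; have [i _ Ux] := XU _ Xx.
  by exists i => //; exists y => //; exists x.
apply: le_trans (volume_bigcup_le _) _.
have diam_ge0 i : (0 <= diam_pow s (U i))%E.
  by rewrite /diam_pow; case: ifP => // _; exact: poweR_ge0.
have SU i : (volume (S i) <=
    (2 ^+ d)%:E * (diam_pow s (U i) + (e / (2 ^ i.+1)%:R)%:E))%E.
  have [/andP[li0 lid] Ul lp] := Pl i.
  apply: le_trans (@volume_sum_le a b t l0 (l i) E (U i) d0 a1 b1 Et _ Ul) _.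
    by rewrite li0 (le_lt_trans lid).
  by rewrite EFinM lee_pmul2l// lte_fin.
apply: le_trans (lee_nneseries _ (fun i _ => SU i)) _.
  by move=> i _ _; exact: volume_ge0.
rewrite nneseriesZl; last first.
  by move=> i _; rewrite adde_ge0// lee_fin ltW.
apply: (@le_trans _ _ ((2 ^+ d)%:E * (e + e)%:E)%E).
  rewrite lee_pmul2l ?lte_fin//.
  apply: le_trans (epsilon_trick xpredT _ (ltW e0)) _ => //.
  by rewrite EFinD leeD2r.
by rewrite -EFinM lee_fin /e -splitr mulrC divfK// gt_eqF.
Qed.

End Covering.

(** * Maximal sets whose sumset avoids Y *)

Theorem theorem2 (R : realType) (d : nat) (beta : R)
    (hd : (1 <= d)%N) (hbeta0 : 0 <= beta) (hbetad : beta < d%:R)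
    (Y : set 'rV[R]_d)
    (hY : exists F : set (set 'rV[R]_d),
        [/\ countable F,
            Y = \bigcup_(E in F) E &
            forall E, F E ->
              bounded_set E /\
              exists2 D, has_minkowski_dim E D & (D <= beta%:E)%E]) :
  exists X : set 'rV[R]_d,
    ((d%:R - beta)%:E <= hausdorff_dim X)%E /\
    [set x + y | x in X & y in X] `&` Y = set0.
Proof.
have [F [Fcount YF Fdim]] := hY.
pose P (X : set 'rV[R]_d) := forall x y, X x -> X y -> ~ Y (x + y).
have [G GP Gtot|X [PX Xmax]] := @Zorn_bigcup _ P.
  move=> x y [A GA Ax] [B GB By].
  by have [AB|BA] := Gtot _ _ GA GB; [apply: (GP _ GB); first exact: AB
    |apply: (GP _ GA) => //; exact: BA].
exists X; split; last first.
  by apply/seteqP; split=> // _ [[x Xx [y Xy <-]] Yxy]; exact: PX Yxy.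
(* If none of the three cases held, z could be added to X. *)
have cover_space z : [\/ X z, Y (z + z) | exists2 x, X x & Y (z + x)].
  have [Xz|nXz] := pselect (X z); first by apply: Or31.
  have [Yzz|nYzz] := pselect (Y (z + z)); first by apply: Or32.
  have [|noY] := pselect (exists2 x, X x & Y (z + x)); first by apply: Or33.
  case: (Xmax (X `|` [set z])).
    split; last by move=> /(_ z (or_intror erefl)).
    by left.
  move=> x y [Xx|->] [Xy|->]; [exact: PX| | |] => //.
    by rewrite addrC => Yzx; apply: noY; exists x.
  by move=> Yzy; apply: noY; exists y.
apply: le_ereal_inf_tmp => _ [s [s0 HX] <-]; rewrite lee_fin leNgt; apply/negP => sd.
pose t := (beta + (d%:R - s)) / 2.
have betat : beta < t by rewrite /t; lra.
have tds : s < d%:R - t by rewrite /t; lra.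
have Fcov E : F E -> exists2 l0, 0 < l0 & covering_exponent t l0 E.
  move=> FE; have [Ebd [D [_ ED] Dbeta]] := Fdim _ FE.
  by apply: minkowski_covering => //; rewrite ED (le_lt_trans Dbeta) ?lte_fin.
(* X is the sum of X and the point 0, a set of Minkowski dimension 0. *)
have X0 : volume X = 0%E.
  have zero_cov : covering_exponent t 1 [set (0 : 'rV[R]_d)].
    move=> l /andP[l0 l1]; exists [:: 0].
      by move=> _ ->; exists 0; rewrite ?mem_seq1//; exact: ballxx.
    rewrite -(powRr0 l); apply: ger_powR; first by rewrite l0 ltW.
    by rewrite oppr_le0 ltW// (le_lt_trans hbeta0).
  rewrite -(volume_sum_eq0 (a := 1) (b := 1) hd _ _ ltr01 zero_cov s0 tds HX) ?normr1//.
  congr volume; apply/seteqP; split=> [x Xx|_ [_ -> [x Xx <-]]].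
    by exists 0 => //; exists x; rewrite // scaler0 add0r scale1r.
  by rewrite scaler0 add0r scale1r.
have halfY0 : volume (\bigcup_(E in F) [set 2^-1 *: e | e in E]) = 0%E.
  apply: volume_countable_bigcup_eq0 => // E /Fcov[l0 l00 El0].
  apply: volume_dilate_eq0 l00 El0 => //; first by rewrite ger0_norm ?invr_ge0; lra.
  by lra.
have YX0 : volume (\bigcup_(E in F) [set 1 *: e + (-1) *: x | e in E & x in X]) = 0%E.
  apply: volume_countable_bigcup_eq0 => // E /Fcov[l0 l00 El0].
  by apply: volume_sum_eq0 l00 El0 s0 tds HX => //; rewrite ?normrN normr1.
have : (volume (@unit_cube R d) <= 0)%E.
  rewrite -(volume_setU_eq0 hd X0 (volume_setU_eq0 hd halfY0 YX0)).
  apply: le_volume => z _; have [Xz|Yzz|[x Xx Yzx]] := cover_space z; first by left.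
    right; left; move: Yzz; rewrite YF => -[E FE Ezz]; exists E => //.
    by exists (z + z) => //; rewrite scalerDr -scalerDl -[2^-1]mul1r -splitr scale1r.
  right; right; move: Yzx; rewrite YF => -[E FE Ezx]; exists E => //.
  by exists (z + x) => //; exists x => //; rewrite scale1r scaleN1r addrK.
apply/negP; rewrite -ltNge; apply: lt_le_trans (volume_unit_cube hd).
by rewrite lte_fin exprn_gt0 ?invr_gt0.
Qed.
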